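(* Let $K(b_{n,k})$ be a Köthe space, let $\theta\in K(b_{n,k})$, and let $\Lambda_\infty(\alpha)$ be a power series space of infinite type. Then the Rhaly operator $R_\theta:\Lambda_\infty(\alpha)\to K(b_{n,k})$ is well-defined and continuous. Furthermore, if $K(b_{n,k})$ is Montel, then $R_\theta$ is also compact. In particular: 1. If $\theta\in\Lambda_\infty(\beta)$, then the operator $R_\theta:\Lambda_\infty(\alpha)\to\Lambda_\infty(\beta)$ is well-defined, continuous and compact. 2. If $\theta\in\Lambda_1(\beta)$, then the operator $R_\theta:\Lambda_\infty(\alpha)\to\Lambda_1(\beta)$ is well-defined, continuous and compact.
   Context: $\mathbb{N}=\{1,2,\dots\}$, $\mathbb{N}_0=\{0,1,2,\dots\}$. A Köthe matrix is a matrix $(b_{n,k})_{n,k\in\mathbb{N}}$ of non-negative numbers such that for each $n$ there is $k$ with $b_{n,k}>0$, and $b_{n,k}\le b_{n,k+1}$ for all $n,k$. The Köthe space is $K(b_{n,k})=\{x=(x_n)_{n\in\mathbb{N}}:\|x\|_k:=\sum_{n=1}^\infty |x_n|b_{n,k}<\infty\ \text{for all }k\in\mathbb{N}\}$, a Fréchet space with the seminorms $\|\cdot\|_k$. $\alpha=(\alpha_n)_{n\in\mathbb{N}}$ and $\beta=(\beta_n)_{n\in\mathbb{N}}$ denote non-negative increasing sequences tending to $\infty$. The power series spaces are the Köthe spaces $\Lambda_\infty(\alpha)=K(e^{k\alpha_n})$ (infinite type) and $\Lambda_1(\alpha)=K(e^{-\frac1k\alpha_n})$ (finite type). $e_n$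 is the sequence with $1$ in the $n$-th place and $0$ elsewhere. A sequence $\theta=(\theta_n)_{n\in\mathbb{N}_0}$ is viewed as an element of a sequence space indexed by $\mathbb{N}$ by taking $\theta_{n-1}$ as its $n$-th coordinate. The Rhaly operator $R_\theta$ is defined by $R_\theta e_n=\sum_{j=n}^\infty \theta_{j-1}e_j$ and $R_\theta x=\sum_{n=1}^\infty x_nR_\theta e_n=\sum_{n=1}^\infty\big(\sum_{j=1}^n x_j\big)\theta_{n-1}e_n$ for $x=\sum_n x_ne_n$ in the domain. It is well-defined if $R_\theta e_n$ lies in the target space for all $n$ and the series $\sum_n x_nR_\theta e_n$ converges in the target space for every $x$ in the domain. A linear map $T:E\to F$ is compact if $T(U)$ is precompact in $F$ for some neighborhood $U$ of zero in $E$. *)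

(* Defs.v *)
From HB Require Import structures.
From mathcomp Require Import all_boot all_order all_algebra.
From mathcomp Require Import complex.
From mathcomp Require Import all_classical all_reals all_analysis.

Set Implicit Arguments.
Unset Strict Implicit.
Unset Printing Implicit Defensive.

Import Order.TTheory GRing.Theory Num.Theory.
Import numFieldNormedType.Exports.

Local Open Scope classical_set_scope.
Local Open Scope ring_scope.

Variant scalar_kind := RealScalars | ComplexScalars.

Definition scalars (R : realType) (c : scalar_kind) : numFieldType :=
  match c with RealScalars => R | ComplexScalars => R[i] end.

(* The norm of an element of R[i] is again an element of R[i], whence Re. *)
Definition modulus (R : realType) (c : scalar_kind) : scalars R c -> R :=
  match c with
  | RealScalars => fun z : R => `|z|
  | ComplexScalars => fun z : R[i] => complex.Re `|z|
  end.

Section modulus_theory.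
Context {R : realType} {c : scalar_kind}.
Implicit Types z w : scalars R c.

Lemma modulus_ge0 z : 0 <= modulus z.
Proof.
case: c z => /= z; first exact: normr_ge0.
by have := normr_ge0 z; rewrite lecE => /andP[].
Qed.

Lemma modulus0 : modulus (0 : scalars R c) = 0.
Proof.
case: c => /=; first exact: normr0.
exact: Normc.normc0.
Qed.

Lemma modulus_eq0 z : modulus z = 0 -> z = 0.
Proof.
case: c z => /= z; first exact: normr0_eq0.
by move=> h; apply: Normc.eq0_normc.
Qed.

Lemma modulusN z : modulus (- z) = modulus z.
Proof.
case: c z => /= z; first exact: normrN.
exact: (congr1 (@complex.Re R) (@normrN _ R[i] z)).
Qed.

Lemma modulusM z w : modulus (z * w) = modulus z * modulus w.
Proof.
case: c z w => /= z w; first exact: normrM.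
exact: Normc.normcM.
Qed.

Lemma modulusD z w : modulus (z + w) <= modulus z + modulus w.
Proof.
case: c z w => /= z w; first exact: ler_normD.
by have := ler_normD z w; rewrite lecE => /andP[].
Qed.

Lemma modulus_conv z : 0 <= z -> z <= 1 -> modulus z + modulus (1 - z) = 1.
Proof.
case: c z => /= z z0 z1.
  by rewrite (@ger0_norm R)// (@ger0_norm R) ?(@subr_ge0 R)// addrC (@subrK R).
have e1 : `|z : R[i]| = z by exact: ger0_norm.
have e2 : `|(1 - z : R[i])| = 1 - z by apply: ger0_norm; rewrite subr_ge0.
have ReD (u v : R[i]) : complex.Re (u + v) = complex.Re u + complex.Re v.
  by case: u; case: v.
apply: etrans (esym (ReD `|z : R[i]| `|(1 - z : R[i])|)) _.
by rewrite e1 e2 addrC subrK.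
Qed.

Lemma near_modulus z (e : R) : 0 < e ->
  \forall w \near (z : (scalars R c)^o), modulus (z - w) < e.
Proof.
case: c z => /= z e0.
  have := @cvgr_dist_lt R R^o R (nbhs (z : R^o)) _ id (z : R^o) (@cvg_id _ _).
  exact.
have e0' : (0 : R[i]) < (e%:C)%C by rewrite ltcR.
apply/(@nbhs_ballP R[i] R[i]^o); exists (e%:C)%C => //= w.
by rewrite -ball_normE /= ltcE /= => /andP[].
Qed.

End modulus_theory.

(* Rows and columns are numbered from 0, so km n k is the entry b_{n+1,k+1} of
   the customary numbering from 1. *)
Record kotheMatrix (R : realType) := KotheMatrix {
  km :> nat -> nat -> R ;
  km_ge0 : forall n k, 0 <= km n k ;
  km_gt0 : forall n, exists k, 0 < km n k ;
  km_nd : forall n k, km n k <= km n k.+1 }.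

Section kothe_pred.
Context {R : realType} (c : scalar_kind) (b : kotheMatrix R).
Local Notation K := (scalars R c).

Definition kothe_sum (k : nat) (x : nat -> K^o) : \bar R :=
  (\sum_(0 <= n <oo) (modulus (x n) * b n k)%:E)%E.

Definition kothe_pred : {pred (nat -> K^o)} :=
  [pred x | `[< forall k, (kothe_sum k x < +oo)%E >] ].

Lemma kothe_term_ge0 (x : nat -> K^o) k n :
  (0 <= (modulus (x n) * b n k)%:E)%E.
Proof. by rewrite lee_fin mulr_ge0 ?modulus_ge0 ?km_ge0. Qed.

Lemma kothe_sum_ge0 k x : (0 <= kothe_sum k x)%E.
Proof. by apply: nneseries_ge0 => n _ _; exact: kothe_term_ge0. Qed.

Lemma kothe_sumD k x y :
  (kothe_sum k (x + y)%R <= kothe_sum k x + kothe_sum k y)%E.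
Proof.
rewrite /kothe_sum -nneseriesD; last 2 first.
- by move=> n _ _; exact: kothe_term_ge0.
- by move=> n _ _; exact: kothe_term_ge0.
apply: lee_nneseries => n _; first by move=> _; exact: kothe_term_ge0.
by rewrite -EFinD lee_fin -mulrDl ler_wpM2r ?km_ge0// modulusD.
Qed.

Lemma kothe_sumZ k (a : K) x :
  kothe_sum k (a *: x)%R = ((modulus a)%:E * kothe_sum k x)%E.
Proof.
rewrite /kothe_sum -nneseriesZl; last by move=> n _; exact: kothe_term_ge0.
by apply: eq_eseriesr => n _; rewrite -EFinM mulrA -modulusM.
Qed.

Lemma kothe_submod_closed : submod_closed kothe_pred.
Proof.
split.
  apply/asboolP => k; rewrite /kothe_sum eseries0 ?ltry// => n _ _.
  by rewrite modulus0 mul0r.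
move=> a x y /asboolP hx /asboolP hy; apply/asboolP => k.
apply: (le_lt_trans (kothe_sumD _ _ _)); rewrite lte_add_pinfty// kothe_sumZ.
rewrite lte_mul_pinfty// ?lee_fin ?modulus_ge0//.
Qed.

End kothe_pred.
Arguments kothe_pred {R} c b.
Arguments kothe_submod_closed {R} c b.

HB.instance Definition _ (R : realType) c (b : kotheMatrix R) :=
  GRing.isSubmodClosed.Build (scalars R c) (nat -> (scalars R c)^o)
    (kothe_pred c b) (kothe_submod_closed c b).

Record kothe (R : realType) (c : scalar_kind) (b : kotheMatrix R) := Kothe {
  kothe_val :> nat -> (scalars R c)^o ;
  _ : kothe_val \in kothe_pred c b }.

HB.instance Definition _ (R : realType) c (b : kotheMatrix R) :=
  [isSub for @kothe_val R c b].
HB.instance Definition _ (R : realType) c (b : kotheMatrix R) :=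
  [Choice of kothe c b by <:].
HB.instance Definition _ (R : realType) c (b : kotheMatrix R) :=
  [SubChoice_isSubLmodule of kothe c b by <:].

Section kothe_topology.
Context {R : realType} {c : scalar_kind} {b : kotheMatrix R}.
Local Notation K := (scalars R c).
Local Notation E := (kothe c b).
Implicit Types x y z : E.

Definition kothe_norm (k : nat) (x : E) : R := fine (kothe_sum b k x).

Lemma kothe_sum_fin_num k x : kothe_sum b k x \is a fin_num.
Proof.
rewrite ge0_fin_numE; last exact: kothe_sum_ge0.
by case: x => x /= hx; have /asboolP := hx; exact.
Qed.

Lemma kothe_norm_ge0 k x : 0 <= kothe_norm k x.
Proof. by apply: fine_ge0; exact: kothe_sum_ge0. Qed.

Lemma kothe_normD k x y : kothe_norm k (x + y) <= kothe_norm k x + kothe_norm k y.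
Proof.
rewrite -lee_fin EFinD /kothe_norm !fineK ?kothe_sum_fin_num//.
exact: kothe_sumD.
Qed.

Lemma kothe_normZ k (a : K) x : kothe_norm k (a *: x) = modulus a * kothe_norm k x.
Proof.
apply: EFin_inj; rewrite EFinM /kothe_norm !fineK ?kothe_sum_fin_num//.
exact: kothe_sumZ.
Qed.

Lemma kothe_norm0 k : kothe_norm k 0 = 0.
Proof. by rewrite -(scale0r 0) kothe_normZ modulus0 mul0r. Qed.

Lemma kothe_normN k x : kothe_norm k (- x) = kothe_norm k x.
Proof.
by rewrite -scaleN1r kothe_normZ -[x in RHS]scale1r kothe_normZ modulusN.
Qed.

Lemma kothe_normC k x y : kothe_norm k (x - y) = kothe_norm k (y - x).
Proof. by rewrite -kothe_normN opprB. Qed.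

Lemma kothe_norm_dist k z x y :
  kothe_norm k (x - y) <= kothe_norm k (x - z) + kothe_norm k (z - y).
Proof. by rewrite -[x - y](subrKA z) kothe_normD. Qed.

Lemma kothe_norm_nd x k l : (k <= l)%N -> kothe_norm k x <= kothe_norm l x.
Proof.
move=> kl; rewrite -lee_fin /kothe_norm !fineK ?kothe_sum_fin_num//.
apply: lee_nneseries => n _; first by move=> _; exact: kothe_term_ge0.
rewrite lee_fin ler_wpM2l ?modulus_ge0//.
by have /nondecreasing_seqP := km_nd b n; exact.
Qed.

Lemma modulus_le_kothe_norm x n k : modulus (x n) * b n k <= kothe_norm k x.
Proof.
rewrite -lee_fin /kothe_norm fineK ?kothe_sum_fin_num// /kothe_sum.
rewrite (nneseriesD1 (n := n))//; last by move=> i _; exact: kothe_term_ge0.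
by rewrite leeDl// nneseries_ge0// => i _ _; exact: kothe_term_ge0.
Qed.

Lemma kothe_ext x y : (forall n, x n = y n) -> x = y.
Proof. by move=> xy; apply/val_inj/funext. Qed.

Lemma kothe_coordD x y n : (x + y) n = x n + y n.
Proof. exact: (congr1 (@^~ n) (raddfD (\val : E -> nat -> K^o) x y)). Qed.

Lemma kothe_coordZ (a : K) x n : (a *: x) n = a * x n.
Proof. exact: (congr1 (@^~ n) (linearZ_LR (\val : E -> nat -> K^o) a x)). Qed.

Lemma kothe_coord_sum I (r : seq I) (f : I -> E) n :
  (\sum_(i <- r) f i) n = \sum_(i <- r) f i n.
Proof.
apply: (big_morph (fun x : E => x n)); first by move=> x y; exact: kothe_coordD.
by rewrite -(scale0r 0) kothe_coordZ mul0r.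
Qed.

Definition kothe_entourage : set_system (E * E) :=
  [set A | exists k, exists2 e : R, 0 < e &
    forall x y, kothe_norm k (x - y) < e -> A (x, y)].

Let entourage_filter : Filter kothe_entourage.
Proof.
split.
- by exists 0, 1.
- move=> A B [k [e e0 eA]] [l [f f0 fB]].
  exists (maxn k l), (Num.min e f); first by rewrite lt_min e0.
  move=> x y; rewrite lt_min => /andP[xe xf]; split.
    by apply: eA; apply: le_lt_trans xe; exact/kothe_norm_nd/leq_maxl.
  by apply: fB; apply: le_lt_trans xf; exact/kothe_norm_nd/leq_maxr.
- by move=> A B AB [k [e e0 eA]]; exists k, e => // x y /eA; exact: AB.
Qed.

Let entourage_diagonal A : kothe_entourage A -> diagonal `<=` A.
Proof.
move=> [k [e e0 eA]] [x y]; rewrite /diagonal /= => ->.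
by apply: eA; rewrite subrr kothe_norm0.
Qed.

Let entourage_inv A : kothe_entourage A -> kothe_entourage A^-1%relation.
Proof.
move=> [k [e e0 eA]]; exists k, e => // x y; rewrite kothe_normC; exact: eA.
Qed.

Let entourage_split_ex A : kothe_entourage A ->
  exists2 B, kothe_entourage B & (B \; B)%relation `<=` A.
Proof.
move=> [k [e e0 eA]].
exists [set xy | kothe_norm k (xy.1 - xy.2) < e / 2].
  by exists k, (e / 2) => //; rewrite divr_gt0.
move=> [x y] /= [z xz zy]; apply: eA.
by rewrite (le_lt_trans (kothe_norm_dist k z x y))// (splitr e) ltrD.
Qed.

HB.instance Definition _ := isPointed.Build E 0.

HB.instance Definition _ := isUniform.Build E
  entourage_filter entourage_diagonal entourage_inv entourage_split_ex.

Lemma nbhs_kotheE x (U : set E) :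
  nbhs x U <-> exists k, exists2 e : R, 0 < e &
    forall y, kothe_norm k (x - y) < e -> U y.
Proof.
split.
  move=> [A [k [e e0 eA]] AU]; exists k, e => // y xy.
  by apply: AU; apply/xsectionP; exact: eA.
move=> [k [e e0 eU]].
pose A : set (E * E) := [set xy | kothe_norm k (xy.1 - xy.2) < e].
have entA : kothe_entourage A.
  by exists k; exists e; [exact: e0 | move=> y z; exact].
by exists A; [exact: entA | move=> y /xsectionP; exact: eU].
Qed.

Lemma nbhs_kothe_ball x k (e : R) : 0 < e ->
  \forall y \near x, kothe_norm k (x - y) < e.
Proof. by move=> e0; apply/nbhs_kotheE; exists k, e. Qed.

Let kothe_add_continuous : continuous (fun x : E * E => x.1 + x.2).
Proof.
move=> [x y] U /= /nbhs_kotheE[k [e e0 eU]].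
have e20 : 0 < e / 2 by rewrite divr_gt0.
exists ([set z | kothe_norm k (x - z) < e / 2],
        [set z | kothe_norm k (y - z) < e / 2]).
  by split; exact: nbhs_kothe_ball.
move=> [x' y'] /= [xx' yy']; apply: eU.
rewrite opprD addrACA (le_lt_trans (kothe_normD _ _ _))//.
by rewrite (splitr e) ltrD.
Qed.

Let kothe_scale_continuous : continuous (fun z : K^o * E => z.1 *: z.2).
Proof.
move=> [a x] U /= /nbhs_kotheE[k [e e0 eU]].
have e20 : 0 < e / 2 by rewrite divr_gt0.
pose d := e / 2 / (kothe_norm k x + 1).
have d0 : 0 < d by rewrite divr_gt0// ltr_wpDl// kothe_norm_ge0.
pose f := e / 2 / (modulus a + d).
have ad0 : 0 < modulus a + d by rewrite ltr_wpDl// modulus_ge0.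
have f0 : 0 < f by rewrite divr_gt0.
exists ([set s | modulus (a - s) < d], [set y | kothe_norm k (x - y) < f]).
  by split; [exact: near_modulus|exact: nbhs_kothe_ball].
move=> [s y] /= [as_ xy]; apply: eU.
have -> : a *: x - s *: y = (a - s) *: x + s *: (x - y).
  by rewrite scalerBl scalerBr addrA subrK.
rewrite (le_lt_trans (kothe_normD _ _ _))// !kothe_normZ (splitr e).
have sle : modulus s <= modulus a + d.
  have {1}-> : s = a + - (a - s) by rewrite subKr.
  by rewrite (le_trans (modulusD _ _))// modulusN lerD// ltW.
rewrite ltr_leD//.
  rewrite (le_lt_trans (y := modulus (a - s) * (kothe_norm k x + 1)))//.
    by rewrite ler_wpM2l ?modulus_ge0// lerDl.
  by rewrite -ltr_pdivlMr// ltr_wpDl// kothe_norm_ge0.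
apply: (@le_trans _ _ ((modulus a + d) * f)).
  by rewrite ler_pM ?modulus_ge0 ?kothe_norm_ge0// ltW.
by rewrite mulrC divfK// gt_eqF.
Qed.

Let kothe_locally_convex :
  exists2 B : set_system E, (forall U, U \in B -> convex_set U) & basis B.
Proof.
exists [set U : set E | exists x k, exists2 e : R, 0 < e &
    U = [set y | kothe_norm k (x - y) < e]].
  move=> U /[!inE] -[x [k [e e0 ->]]].
  apply/convex_setW => y z /[!inE]/= xy xz l l0 l1.
  pose m := Num.max (kothe_norm k (x - y)) (kothe_norm k (x - z)).
  have me : m < e by rewrite gt_max xy.
  rewrite inE /=; apply: le_lt_trans me.
  pose t : K := l%:num.
  change (kothe_norm k (x - (t *: y + (1 - t) *: z)) <= m).
  have -> : x - (t *: y + (1 - t) *: z) = t *: (x - y) + (1 - t) *: (x - z).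
    by rewrite !scalerBr addrACA -opprD -scalerDl subrKC scale1r.
  rewrite (le_trans (kothe_normD _ _ _))// !kothe_normZ.
  have -> : m = modulus t * m + modulus (1 - t) * m.
    by rewrite -mulrDl modulus_conv ?mul1r// ltW.
  by rewrite lerD// ler_wpM2l ?modulus_ge0// le_max lexx ?orbT.
split.
  move=> _ [x [k [e e0 ->]]]; rewrite openE => y /= xy.
  apply/nbhs_kotheE; exists k, (e - kothe_norm k (x - y)).
    by rewrite subr_gt0.
  move=> z yz /=; apply: (le_lt_trans (kothe_norm_dist k y x z)).
  by rewrite -ltrBrDl.
move=> x U /= /nbhs_kotheE[k [e e0 eU]].
exists [set y | kothe_norm k (x - y) < e] => //.
by split; [exists x, k, e|rewrite /= subrr kothe_norm0].
Qed.

HB.instance Definition _ := PreTopologicalNmodule_isTopologicalNmodule.Build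
  E kothe_add_continuous.
HB.instance Definition _ := TopologicalNmodule_isTopologicalLmodule.Build
  K E kothe_scale_continuous.
HB.instance Definition _ := Uniform_isTvs.Build K E kothe_locally_convex.

End kothe_topology.

(* As for the columns of a Koethe matrix, es n is the entry alpha_{n+1}. *)
Record exponentSeq (R : realType) := ExponentSeq {
  es :> nat -> R ;
  es_ge0 : forall n, 0 <= es n ;
  es_nd : forall n, es n <= es n.+1 ;
  es_cvg : es n @[n --> \oo] --> +oo }.

Section power_series.
Context {R : realType} (alpha : exponentSeq R).

Let inf_nd n k : expR (k.+1%:R * alpha n) <= expR (k.+2%:R * alpha n).
Proof. by rewrite ler_expR ler_wpM2r ?es_ge0// ler_nat. Qed.

Definition power_series_inf : kotheMatrix R :=
  @KotheMatrix R (fun n k => expR (k.+1%:R * alpha n))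
    (fun n k => expR_ge0 _) (fun n => ex_intro _ 0 (expR_gt0 _)) inf_nd.

Let fin_nd n k : expR (- (k.+1%:R^-1 * alpha n)) <=
                 expR (- (k.+2%:R^-1 * alpha n)).
Proof.
by rewrite ler_expR lerN2 ler_wpM2r ?es_ge0// lef_pV2 ?posrE// ler_nat.
Qed.

Definition power_series_fin : kotheMatrix R :=
  @KotheMatrix R (fun n k => expR (- (k.+1%:R^-1 * alpha n)))
    (fun n k => expR_ge0 _) (fun n => ex_intro _ 0 (expR_gt0 _)) fin_nd.

End power_series.

Section tvs_notions.
Context {K : numFieldType}.

Definition tvs_bounded (E : tvsType K) (B : set E) : Prop :=
  forall U : set E, nbhs 0 U ->
    exists2 r : K, 0 < r & forall s : K, r <= `|s| -> B `<=` *:%R s @` U.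

(* Barrelledness, the other half of the definition of a Montel space, is
   automatic for Frechet spaces. *)
Definition montel (E : tvsType K) : Prop :=
  forall B : set E, tvs_bounded B -> precompact B.

Definition compact_operator (E F : tvsType K) (T : E -> F) : Prop :=
  linear T /\ exists2 U : set E, nbhs 0 U & precompact (T @` U).

End tvs_notions.

Section rhaly.
Context {R : realType} {c : scalar_kind}.
Local Notation K := (scalars R c).
Variables (a b : kotheMatrix R) (theta : nat -> K^o).

(* R_theta e_n, the coordinate j of which is theta j since theta starts at
   index 0. *)
Definition rhaly_col (n : nat) : nat -> K^o :=
  fun j => if (n <= j)%N then theta j else 0.

(* insubd yields rhaly_col n itself as soon as it belongs to the target. *)
Definition rhaly_series (x : kothe c a) : nat -> kothe c b :=
  series (fun n => (x n : K) *: insubd (0 : kothe c b) (rhaly_col n)).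

Definition rhaly (x : kothe c a) : kothe c b := lim (rhaly_series x @ \oo).

Definition rhaly_well_defined : Prop :=
  (forall n, rhaly_col n \in kothe_pred c b) /\
  (forall x : kothe c a, cvgn (rhaly_series x)).

Hypothesis wd : rhaly_well_defined.

Lemma rhalyE (x : kothe c a) n :
  rhaly x n = (\sum_(j < n.+1) (x j : K)) * theta n.
Proof.
have [col cvx] := wd.
have xL : rhaly_series x @ \oo --> rhaly x by exact: (cvx x).
have [k bnk] := km_gt0 b n.
pose v := (\sum_(j < n.+1) (x j : K)) * theta n.
have seriesE m : (n < m)%N -> rhaly_series x m n = v.
  move=> nm; rewrite /rhaly_series /series /=.
  rewrite kothe_coord_sum /v mulr_suml.
  under eq_bigr do rewrite kothe_coordZ insubdK//.
  rewrite (big_cat_nat (n := n.+1))//= [X in _ + X]big1_seq ?addr0; last first.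
    move=> i; rewrite mem_index_iota => /andP[_ /andP[ni _]].
    by rewrite /rhaly_col leqNgt ni /= mulr0.
  rewrite big_mkord; apply: eq_bigr => i _.
  by rewrite /rhaly_col -ltnS ltn_ord.
suff : modulus (rhaly x n - v) * b n k <= 0.
  rewrite pmulr_lle0// => h; apply/eqP; rewrite -subr_eq0; apply/eqP.
  by apply: modulus_eq0; apply/eqP; rewrite eq_le h modulus_ge0.
apply/ler_addgt0Pr => e e0; rewrite add0r.
have h1 := xL _ (nbhs_kothe_ball (rhaly x) k e0).
have h2 : \forall m \near \oo, (n < m)%N by exact: nbhs_infty_gt.
near \oo => m.
have lt1 : kothe_norm k (rhaly x - rhaly_series x m) < e by near: m.
rewrite -(seriesE m); last by near: m.
exact: le_trans (modulus_le_kothe_norm (rhaly x - rhaly_series x m) n k) (ltW lt1).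
Unshelve. all: end_near. Qed.

Lemma rhaly_linear : linear rhaly.
Proof.
move=> s x y; apply: kothe_ext => n.
rewrite kothe_coordD kothe_coordZ !rhalyE mulrA -mulrDl; congr (_ * _).
rewrite mulr_sumr -big_split; apply: eq_bigr => j _.
exact: etrans (kothe_coordD _ _ _) (congr1 (+%R^~ _) (kothe_coordZ _ _ _)).
Qed.

End rhaly.

Arguments rhaly {R c} a b theta.
Arguments rhaly_well_defined {R c} a b theta.

(* Main.v *)
(** Since [expR (alpha n) >= 1], the first seminorm of [x] bounds its partial
    sums, and the tails of that seminorm bound the tails of the sum. So
    [R_theta x] and the remainders of its defining series are dominated
    coordinatewise by multiples of [theta], with factors tending to [0] for the
    remainders; this gives convergence and continuity. Moreover [R_theta] maps
    the unit ball of the first seminorm into the order interval of all [y] with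
    [|y n| <= |theta n|], and such an interval is compact in every Koethe
    space. *)

Require Import Defs.
From mathcomp Require Import all_boot all_order all_algebra.
From mathcomp Require Import complex.
From mathcomp Require Import all_classical all_reals all_analysis.

Set Implicit Arguments.
Unset Strict Implicit.
Unset Printing Implicit Defensive.

Import Order.TTheory GRing.Theory Num.Theory.
Import numFieldNormedType.Exports.

Local Open Scope classical_set_scope.
Local Open Scope ring_scope.

(** * Modulus estimates and compactness of closed disks of scalars *)

Section modulus_bounds.
Context {R : realType} {c : scalar_kind}.
Local Notation K := (scalars R c).

Lemma modulusB (z w : K) : modulus (z - w) <= modulus z + modulus w.
Proof. by rewrite -(modulusN w) modulusD. Qed.

Lemma modulus_sum (f : nat -> K) m n :
  modulus (\sum_(m <= j < n) f j) <= \sum_(m <= j < n) modulus (f j).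
Proof.
elim/big_rec2: _ => [|j u v _ uv]; first by rewrite modulus0.
by rewrite (le_trans (modulusD _ _))// lerD2l.
Qed.

Lemma closed_modulus_le (r : R) : closed [set z : K^o | modulus z <= r].
Proof.
move=> z clz /=; apply/ler_addgt0Pr => e e0.
have [w [/= wr zw]] := clz _ (near_modulus z e0).
rewrite -(subrK w z) (le_trans (modulusD _ _))// addrC lerD// ltW//.
Qed.

End modulus_bounds.

(** The rectangle is the continuous image of a product of two segments; it is there to enclose the
    closed disks of the complex plane. *)
Lemma compact_complex_rectangle (R : realType) (r : R) :
  compact [set z : R[i]^o | `|complex.Re z| <= r /\ `|complex.Im z| <= r].
Proof.
pose f (p : R * R) : R[i]^o := (p.1 +i* p.2)%C.
have f_continuous : continuous f.
  move=> [x y]; apply/(@cvgrPdist_lt R[i] R[i]^o) => e.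
  (* The radius is an element of [R[i]]; being positive, it has imaginary part [0]. *)
  case: e => e e' /[dup]; rewrite ltcE /= => /andP[/eqP -> e0] _.
  have e20 : 0 < e / 2 by rewrite divr_gt0.
  near=> p.
  have xp : `|x - p.1| < e / 2.
    near: p; apply: (@cvgr_dist_lt _ R^o _ _ _ fst x) => //; exact: cvg_fst.
  have yp : `|y - p.2| < e / 2.
    near: p; apply: (@cvgr_dist_lt _ R^o _ _ _ snd y) => //; exact: cvg_snd.
  rewrite normc_def ltcR /= (le_lt_trans (y := `|x - p.1| + `|y - p.2|))//; last first.
    by rewrite (splitr e) ltrD.
  (* Compare squares: the right-hand side has an additional non-negative cross term. *)
  rewrite -(ler_pXn2r (n := 2))// ?nnegrE ?addr_ge0// sqr_sqrtr ?addr_ge0 ?sqr_ge0//.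
  rewrite [leRHS]sqrrD !real_normK ?num_real// lerD2r lerDl mulrn_wge0//.
have -> : [set z : R[i]^o | `|complex.Re z| <= r /\ `|complex.Im z| <= r] =
    f @` (`[- r, r] `*` `[- r, r]).
  apply/seteqP; split=> [[x y] /= [xr yr]|_ [[x y] /= [xr yr] <-]] /=.
    by exists (x, y) => //; split; rewrite /= in_itv /= -ler_norml.
  by move: xr yr; rewrite !in_itv /= -!ler_norml.
apply: continuous_compact; first exact: continuous_subspaceT.
by apply: compact_setX; exact: segment_compact.
Unshelve. all: end_near. Qed.

(** A closed disk is a closed subset of a compact rectangle, or of a segment for real scalars. *)
Lemma compact_modulus_le {R : realType} {c : scalar_kind} (r : R) :
  compact [set z : (scalars R c)^o | modulus z <= r].
Proof.
case: c; last first.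
  have rect := @compact_complex_rectangle R r.
  apply: subclosed_compact (@closed_modulus_le R ComplexScalars r) rect _.
  move=> [x y] /= h; have xyr : Num.sqrt (x ^+ 2 + y ^+ 2) <= r by []; split.
    by rewrite (le_trans _ xyr)// -sqrtr_sqr ler_wsqrtr// lerDl sqr_ge0.
  by rewrite (le_trans _ xyr)// -sqrtr_sqr ler_wsqrtr// lerDr sqr_ge0.
have seg := @segment_compact R (- r) r.
apply: subclosed_compact (@closed_modulus_le R RealScalars r) seg _.
by move=> x /=; rewrite in_itv /= -ler_norml.
Qed.

(** * Domination and order intervals in Koethe spaces *)

Section kothe_theory.
Context {R : realType} {c : scalar_kind} {b : kotheMatrix R}.
Local Notation K := (scalars R c).
Implicit Types x y theta : kothe c b.

Lemma kothe_coordB x y n : (x - y) n = x n - y n.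
Proof. by rewrite kothe_coordD -scaleN1r kothe_coordZ mulN1r. Qed.

(** Each row has a positive entry, so some seminorm controls the given coordinate. This is what
    allows passing from compact to precompact. *)
Lemma hausdorff_kothe : hausdorff_space (kothe c b).
Proof.
move=> x y xy; apply: kothe_ext => n.
have [k bnk] := km_gt0 b n.
apply/eqP; rewrite -subr_eq0; apply/eqP/modulus_eq0/eqP.
rewrite eq_le modulus_ge0 andbT -(pmulr_lle0 _ bnk).
apply/ler_addgt0Pr => e e0; rewrite add0r.
have e20 : 0 < e / 2 by rewrite divr_gt0.
have [z [/= xz yz]] := xy _ _ (nbhs_kothe_ball x k e20) (nbhs_kothe_ball y k e20).
rewrite -kothe_coordB.
apply: le_trans (modulus_le_kothe_norm (x - y) n k) _.
apply: le_trans (kothe_norm_dist k z x y) _.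
by rewrite (splitr e) [kothe_norm k (z - y)]kothe_normC; exact: lerD (ltW xz) (ltW yz).
Qed.

Lemma kothe_sum_tail_cvg k theta :
  (\sum_(N <= n <oo) (modulus (theta n) * b n k)%:E)%E @[N --> \oo] --> 0%E.
Proof.
apply: (@nneseries_tail_cvg R (fun n => (modulus (theta n) * b n k)%:E) xpredT).
- by rewrite ltey_eq kothe_sum_fin_num.
- by move=> n _; exact: kothe_term_ge0.
Qed.

(** Here [y] is a bare sequence, so that the bound can also prove its membership in the space. *)
Lemma kothe_sum_dominated (y : nat -> K^o) theta (M : R) k :
  0 <= M -> (forall n, modulus (y n) <= M * modulus (theta n)) ->
  (kothe_sum b k y <= (M * kothe_norm k theta)%:E)%E.
Proof.
move=> M0 yM; rewrite EFinM fineK ?kothe_sum_fin_num//.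
rewrite -nneseriesZl; last by move=> n _; exact: kothe_term_ge0.
apply: lee_nneseries => n _; first by move=> _; exact: kothe_term_ge0.
by rewrite -EFinM lee_fin mulrA ler_wpM2r ?km_ge0.
Qed.

Lemma kothe_pred_dominated (y : nat -> K^o) theta (M : R) :
  0 <= M -> (forall n, modulus (y n) <= M * modulus (theta n)) ->
  y \in kothe_pred c b.
Proof.
move=> M0 yM; apply/asboolP => k.
exact: le_lt_trans (kothe_sum_dominated k M0 yM) (ltry _).
Qed.

Lemma kothe_norm_dominated y theta (M : R) k :
  0 <= M -> (forall n, modulus (y n) <= M * modulus (theta n)) ->
  kothe_norm k y <= M * kothe_norm k theta.
Proof.
move=> M0 yM; rewrite -lee_fin fineK ?kothe_sum_fin_num//.
exact: kothe_sum_dominated.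
Qed.

(* On the order interval the tails of the seminorms are uniformly small, so the
   coordinatewise topology, for which it is compact by Tychonoff, is finer than
   the topology of the Koethe space. *)
Lemma compact_order_interval theta :
  compact [set y : kothe c b | forall n, modulus (y n) <= modulus (theta n)].
Proof.
pose P : topologicalType := prod_topology (fun _ : nat => K^o).
pose D : set P := [set u : nat -> K^o | forall n, modulus (u n) <= modulus (theta n)].
have DP (u : P) : D u -> (u : nat -> K^o) \in kothe_pred c b.
  by move=> Du; apply: (@kothe_pred_dominated _ theta 1) => // n; rewrite mul1r.
(* The default [0] is never taken on [D], by [DP]. *)
pose f (u : P) : kothe c b := insubd (0 : kothe c b) (u : nat -> K^o).
have fE (u : P) n : D u -> f u n = (u : nat -> K^o) n.
  by move=> Du; rewrite /f insubdK//; exact: DP.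
have -> : [set y : kothe c b | forall n, modulus (y n) <= modulus (theta n)] = f @` D.
  apply/seteqP; split=> [y Dy|_ [u Du <-] n]; last by rewrite fE//; exact: Du.
  by exists (y : nat -> K^o) => //; apply: kothe_ext => n; rewrite fE.
apply: continuous_compact; last first.
  exact: (@tychonoff nat (fun=> K^o) (fun n => [set z | modulus z <= modulus (theta n)])
    (fun n => @compact_modulus_le R c _)).
apply/subspace_continuousP => u Du U /nbhs_kotheE[k [e e0 eU]].
have e40 : 0 < e / 2 / 2 by rewrite !divr_gt0.
(* A quarter of [e], since the tail of [f u - f v] is bounded by twice the tail of [theta]; the
   first [N] terms get the other half of [e]. *)
have [N _ /(_ N (leqnn _)) tailN] : \forall N \near \oo,
    (\sum_(N <= n <oo) (modulus (theta n) * b n k)%:E < (e / 2 / 2)%:E)%E.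
  have e4E : (0 < (e / 2 / 2)%:E)%E by rewrite lte_fin.
  exact: (@kothe_sum_tail_cvg k theta _ (open_ereal_lt' e4E)).
have S0 : 0 < \sum_(0 <= n < N) b n k + 1.
  by rewrite ltr_wpDl// sumr_ge0// => n _; exact: km_ge0.
pose d := e / 2 / (\sum_(0 <= n < N) b n k + 1).
have d0 : 0 < d by rewrite !divr_gt0.
(* Only finitely many coordinates are constrained, so this is a neighbourhood in the product
   topology. *)
have near_coord : \forall v \near u, forall n : 'I_N,
    modulus ((u : nat -> K^o) n - (v : nat -> K^o) n) < d.
  have near_n (n : 'I_N) := @proj_continuous nat (fun=> K^o) n u _ (near_modulus _ d0).
  exact: (filter_forall (nbhs_filter u) near_n).
apply: filterS near_coord => v uv Dv.
apply: eU; rewrite -lte_fin fineK ?kothe_sum_fin_num//.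
rewrite /kothe_sum (nneseries_split 0 N); last first.
  by move=> n _; exact: kothe_term_ge0.
rewrite add0n (splitr e) EFinD.
have tail_term_ge0 n : (0 <= (modulus (theta n) * b n k)%:E)%E by exact: kothe_term_ge0.
have tail_fin : (\sum_(N <= n <oo) (modulus (theta n) * b n k)%:E)%E \is a fin_num.
  rewrite ge0_fin_numE ?nneseries_ge0//.
  exact: lt_trans tailN (ltry _).
have tail_le : (\sum_(N <= n <oo) (modulus ((f u - f v) n) * b n k)%:E <=
    \sum_(N <= n <oo) (modulus (theta n) * b n k)%:E +
    \sum_(N <= n <oo) (modulus (theta n) * b n k)%:E)%E.
  rewrite -nneseriesD//.
  apply: lee_nneseries => n _; first by move=> _; exact: kothe_term_ge0.
  rewrite -EFinD lee_fin -mulrDl ler_wpM2r ?km_ge0// kothe_coordB !fE//.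
  by rewrite (le_trans (modulusB _ _))// lerD.
have head_le : (\sum_(0 <= n < N) (modulus ((f u - f v) n) * b n k)%:E <= (e / 2)%:E)%E.
  rewrite sumEFin lee_fin.
  apply: (@le_trans _ _ (d * (\sum_(0 <= n < N) b n k + 1))).
    rewrite mulrDr mulr1 ler_wpDr ?(ltW d0)// mulr_sumr.
    apply: ler_sum_nat => n /andP[_ nN]; rewrite ler_wpM2r ?km_ge0//.
    rewrite kothe_coordB !fE//; exact: ltW (uv (Ordinal nN)).
  by rewrite divfK// gt_eqF.
apply: lee_ltD; [by rewrite sumEFin|exact: head_le|].
apply: le_lt_trans tail_le _.
rewrite [X in X%:E](splitr (e / 2)) EFinD; exact: lteD.
Qed.

End kothe_theory.

(** * The Rhaly operator on a domain with first column at least [1] *)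

Section rhaly_theory.
Context {R : realType} {c : scalar_kind} (a b : kotheMatrix R).
(** This makes the first seminorm dominate the l1 norm. *)
Hypothesis a_ge1 : forall n, 1 <= a n 0%N.
Local Notation K := (scalars R c).
Implicit Types (x : kothe c a) (theta : kothe c b).

(** The weights are at least [1]. With [m = 0] the right-hand side is the first seminorm and bounds
    the partial sums; as [m] grows it tends to [0] and bounds the remainders. *)
Lemma modulus_sum_le_tail x m n :
  ((modulus (\sum_(m <= j < n) (x j : K)))%:E <=
    \sum_(m <= j <oo) (modulus (x j) * a j 0)%:E)%E.
Proof.
apply: le_trans (nneseries_lim_ge (P := xpredT) n _); last first.
  by move=> j _ _; exact: kothe_term_ge0.
rewrite sumEFin lee_fin (le_trans (modulus_sum _ _ _))//.
by apply: ler_sum => j _; rewrite ler_peMr ?modulus_ge0.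
Qed.

Lemma modulus_partial_sum_le x n :
  modulus (\sum_(j < n) (x j : K)) <= kothe_norm 0 x.
Proof.
rewrite -lee_fin fineK ?kothe_sum_fin_num// -(big_mkord xpredT (fun j => x j : K)).
exact: modulus_sum_le_tail.
Qed.

Lemma rhaly_col_kothe_pred theta n : rhaly_col theta n \in kothe_pred c b.
Proof.
apply: (@kothe_pred_dominated _ _ _ _ theta 1) => // j.
by rewrite mul1r /rhaly_col; case: ifP => // _; rewrite modulus0 modulus_ge0.
Qed.

(** Column [j] contributes to coordinate [n] only if [j <= n], hence the cut at [n.+1]. *)
Lemma rhaly_seriesE theta x m n :
  rhaly_series b theta x m n = (\sum_(0 <= j < minn m n.+1) (x j : K)) * theta n.
Proof.
rewrite /rhaly_series /series /= kothe_coord_sum mulr_suml.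
under eq_bigr do rewrite kothe_coordZ insubdK ?rhaly_col_kothe_pred//.
rewrite (big_cat_nat (n := minn m n.+1)) ?geq_minl//=.
rewrite [X in _ + X]big1_seq ?addr0; last first.
  move=> j; rewrite mem_index_iota geq_min => /andP[_ /andP[+ jm]].
  by rewrite leqNgt jm /= /rhaly_col ltnNge => /negPf ->; rewrite mulr0.
rewrite big_nat_cond [RHS]big_nat_cond; apply: eq_bigr => j.
by rewrite andbT leq_min => /andP[_ /andP[_ jn]]; rewrite /rhaly_col -ltnS jn.
Qed.

Lemma rhaly_well_defined_ge1 theta : rhaly_well_defined a b theta.
Proof.
split=> [|x]; first exact: rhaly_col_kothe_pred.
(* The candidate limit is the coordinatewise one. *)
pose y n : K^o := (\sum_(j < n.+1) (x j : K)) * theta n.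
have y_pred : y \in kothe_pred c b.
  apply: (@kothe_pred_dominated _ _ _ _ theta (kothe_norm 0 x)).
    exact: kothe_norm_ge0.
  by move=> n; rewrite modulusM ler_wpM2r ?modulus_ge0 ?modulus_partial_sum_le.
apply/cvg_ex; exists (Kothe y_pred) => U /nbhs_kotheE[k [e e0 eU]].
(* Adding [1] avoids a zero denominator when the seminorm of [theta] vanishes. *)
have d0 : 0 < e / (kothe_norm k theta + 1).
  by rewrite divr_gt0// ltr_wpDl// kothe_norm_ge0.
have d0E : (0 < (e / (kothe_norm k theta + 1))%:E)%E by rewrite lte_fin.
have near_tail : \forall m \near \oo,
    (\sum_(m <= j <oo) (modulus (x j) * a j 0)%:E <
      (e / (kothe_norm k theta + 1))%:E)%E.
  exact: (@kothe_sum_tail_cvg _ _ _ 0 x _ (open_ereal_lt' d0E)).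
change (\forall m \near \oo, U (rhaly_series b theta x m)).
apply: filterS near_tail => m /= tail_lt; apply: eU.
set t := (\sum_(m <= j <oo) (modulus (x j) * a j 0)%:E)%E in tail_lt.
have t0 : (0 <= t)%E by apply: nneseries_ge0 => j _ _; exact: kothe_term_ge0.
have t_fin : t \is a fin_num by rewrite ge0_fin_numE// (lt_trans tail_lt)// ltry.
rewrite -(fineK t_fin) lte_fin in tail_lt.
apply: (@le_lt_trans _ _ (fine t * kothe_norm k theta)).
  apply: kothe_norm_dominated => [|n]; first exact: fine_ge0.
  rewrite kothe_coordB rhaly_seriesE /= /y -mulrBl modulusM.
  rewrite ler_wpM2r ?modulus_ge0// -lee_fin fineK//.
  rewrite -(big_mkord xpredT (fun j => x j : K)).
  rewrite (big_cat_nat (n := minn m n.+1)) ?geq_minr//= addrAC subrr add0r.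
  (* For [m <= n.+1] the terms from [m] to [n] are still missing; beyond that, coordinate [n] has
     reached its final value. *)
  have [mn|nm] := leqP m n.+1; first exact: modulus_sum_le_tail.
  by rewrite big_geq// modulus0.
rewrite ltr_pdivlMr// in tail_lt; last by rewrite ltr_wpDl// kothe_norm_ge0.
apply: le_lt_trans tail_lt; rewrite ler_wpM2l ?fine_ge0//.
by rewrite lerDl.
Qed.

Lemma modulus_rhaly_le theta x n :
  modulus (rhaly a b theta x n) <= kothe_norm 0 x * modulus (theta n).
Proof.
rewrite rhalyE; last exact: rhaly_well_defined_ge1.
by rewrite modulusM ler_wpM2r ?modulus_ge0 ?modulus_partial_sum_le.
Qed.

(** Seminorm [k] of the image is at most [kothe_norm k theta] times the first seminorm of the
    argument. *)
Lemma rhaly_continuous theta : continuous (rhaly a b theta).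
Proof.
move=> x U /nbhs_kotheE[k [e e0 eU]].
have M0 : 0 < kothe_norm k theta + 1 by rewrite ltr_wpDl// kothe_norm_ge0.
apply/nbhs_kotheE; exists 0%N, (e / (kothe_norm k theta + 1)).
  by rewrite divr_gt0.
move=> y; rewrite ltr_pdivlMr// => xy; apply: eU.
have lin := rhaly_linear (rhaly_well_defined_ge1 theta).
have -> : rhaly a b theta x - rhaly a b theta y = rhaly a b theta (x - y).
  (* [linear] speaks of [s *: u + v], so the difference is written with [s = -1]. *)
  by rewrite -scaleN1r addrC -lin scaleN1r addrC.
apply: le_lt_trans xy; apply: (@le_trans _ _ (kothe_norm 0 (x - y) * kothe_norm k theta)).
  apply: kothe_norm_dominated => [|n]; first exact: kothe_norm_ge0.
  exact: modulus_rhaly_le.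
by rewrite ler_wpM2l ?kothe_norm_ge0// lerDl.
Qed.

Lemma rhaly_compact theta : compact_operator (rhaly a b theta).
Proof.
split; first exact: (rhaly_linear (rhaly_well_defined_ge1 theta)).
exists [set x | kothe_norm 0 (0 - x) < 1]; first exact: nbhs_kothe_ball.
apply: (precompact_subset _ (compact_precompact hausdorff_kothe
  (compact_order_interval (theta := theta)))) => _ [x /= x1 <-] n.
apply: le_trans (modulus_rhaly_le theta x n) _.
by rewrite ler_piMl ?modulus_ge0// -kothe_normN -sub0r ltW.
Qed.

End rhaly_theory.

Theorem theorem3p3 (R : realType) (c : scalar_kind) (alpha : exponentSeq R) :
  (forall (b : kotheMatrix R) (theta : nat -> (scalars R c)^o),
     theta \in kothe_pred c b ->
     let T := rhaly (power_series_inf alpha) b theta in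
     [/\ rhaly_well_defined (power_series_inf alpha) b theta,
         continuous T
       & montel (kothe c b) -> compact_operator T])
  /\
  (forall (beta : exponentSeq R) (theta : nat -> (scalars R c)^o),
     theta \in kothe_pred c (power_series_inf beta) ->
     let T := rhaly (power_series_inf alpha) (power_series_inf beta) theta in
     [/\ rhaly_well_defined (power_series_inf alpha) (power_series_inf beta) theta,
         continuous T
       & compact_operator T])
  /\
  (forall (beta : exponentSeq R) (theta : nat -> (scalars R c)^o),
     theta \in kothe_pred c (power_series_fin beta) ->
     let T := rhaly (power_series_inf alpha) (power_series_fin beta) theta in
     [/\ rhaly_well_defined (power_series_inf alpha) (power_series_fin beta) theta,
         continuous T
       & compact_operator T]).
Proof.
(* Column [0] carries the factor [1], so its entries are [expR (alpha n)] with [alpha n >= 0]. *)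
have power_series_inf_ge1 n : 1 <= power_series_inf alpha n 0%N.
  by rewrite /= -expR0 ler_expR mulr_ge0 ?es_ge0.
have rhalyP (b : kotheMatrix R) (theta : nat -> (scalars R c)^o) :
    theta \in kothe_pred c b ->
    [/\ rhaly_well_defined (power_series_inf alpha) b theta,
        continuous (rhaly (power_series_inf alpha) b theta)
      & compact_operator (rhaly (power_series_inf alpha) b theta)].
  move=> theta_pred; split.
  - exact: (rhaly_well_defined_ge1 power_series_inf_ge1 (Kothe theta_pred)).
  - exact: (rhaly_continuous power_series_inf_ge1 (theta := Kothe theta_pred)).
  - exact: (rhaly_compact power_series_inf_ge1 (Kothe theta_pred)).
split; last by split=> beta theta; exact: rhalyP.
by move=> b theta /rhalyP[wd cont cpt]; split.
Qed.
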